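(* Let $A\in\mathbb{R}^{m\times n}$, and let $f:\mathbb{R}_+^m\to\mathbb{R}$ be increasing in each argument. Suppose that $H\in\mathbb{R}^{n\times m}$ is an optimal solution of the problem $$\min\{\, f(\|H_{\cdot 1}\|_2,\|H_{\cdot 2}\|_2,\ldots,\|H_{\cdot m}\|_2)\;:\; H\in\mathbb{R}^{n\times m},\ AHA=A\,\}.$$ Then $HAH=H$ and $(HA)^{\top}=HA$.
   Context: $H_{\cdot j}$ denotes the $j$-th column of $H$, $\|\cdot\|_2$ is the Euclidean norm, and $\mathbb{R}_+$ is the set of non-negative reals. ''Increasing in each argument'' means strictly increasing in each argument when the other arguments are held fixed (as distinguished from non-decreasing). *)

(* Defs.v *)
From mathcomp Require Import all_boot all_order all_algebra.
From mathcomp Require Import reals.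

Set Implicit Arguments.
Unset Strict Implicit.
Unset Printing Implicit Defensive.

Import Order.TTheory GRing.Theory Num.Theory.
Local Open Scope ring_scope.

(* The library norm `|v| on matrices is the sup norm, hence this definition. *)
Definition norm2 (R : realType) (n : nat) (v : 'cV[R]_n) : R :=
  Num.sqrt (\sum_(i < n) v i 0 ^+ 2).

Definition col_norms (R : realType) (n m : nat) (H : 'M[R]_(n, m)) : 'rV[R]_m :=
  \row_(j < m) norm2 (col j H).

(* A function on the non-negative orthant is represented by a total function on
   R^m, whose values outside of the orthant are irrelevant: only points x and y
   of the orthant are compared. *)
Definition increasing_in_each_argument (R : realType) (m : nat)
    (f : 'rV[R]_m -> R) : Prop :=
  forall (j : 'I_m) (x y : 'rV[R]_m),
    (forall i, 0 <= x 0 i) -> (forall i, 0 <= y 0 i) ->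
    (forall i, i != j -> x 0 i = y 0 i) ->
    x 0 j < y 0 j -> f x < f y.

Definition is_minimizer (R : realType) (T : Type) (feasible : T -> Prop)
    (obj : T -> R) (x : T) : Prop :=
  feasible x /\ forall y, feasible y -> obj x <= obj y.

(* Main.v *)
Require Import Defs.
From mathcomp Require Import all_boot all_order all_algebra.
From mathcomp Require Import reals.

(** Let [P] be the orthogonal projector onto the row space of [A], so that
    [A P = A] and [P = C A] for some [C]. Then [P H] is again feasible, and by
    Pythagoras its columns are no longer than those of [H], and strictly shorter
    for every column not fixed by [P]. Minimality and strict monotonicity thus
    force [P H = H], whence [H A = P H A = C (A H A) = C A = P], which is
    symmetric, and [H A H = P H = H]. *)

Import Order.TTheory GRing.Theory Num.Theory.
Local Open Scope ring_scope.

Lemma trmx_mul_self (R : pzRingType) (n : nat) (v : 'cV[R]_n) :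
  (v^T *m v) 0 0 = \sum_i v i 0 ^+ 2.
Proof. by rewrite mxE; apply: eq_bigr => i _; rewrite mxE expr2. Qed.

Lemma sum_sqr_eq0 (R : realDomainType) (n : nat) (v : 'cV[R]_n) :
  (\sum_i v i 0 ^+ 2 == 0) = (v == 0).
Proof.
apply/idP/eqP => [|->]; last first.
  by apply/eqP/big1 => i _; rewrite mxE expr0n.
rewrite psumr_eq0 => [/allP v0|i _]; last exact: sqr_ge0.
apply/colP => i; apply/eqP; rewrite mxE -(sqrf_eq0 (v i 0)).
by have := v0 i (mem_index_enum _).
Qed.

(** If [v *m B *m B^T = 0], then multiplying by [v^T] on the right shows that the squared length of
    [v *m B] is 0, so [v = 0] by freeness of [B]. *)
Lemma row_free_gram (R : realFieldType) (r n : nat) (B : 'M[R]_(r, n)) :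
  row_free B -> B *m B^T \in unitmx.
Proof.
move=> freeB; rewrite -row_free_unit; apply/row_freeP.
apply/row_freeP/inj_row_free => v vG0; apply: (row_free_inj freeB).
rewrite mul0mx; apply/trmx_inj/eqP; rewrite trmx0 -sum_sqr_eq0.
by rewrite -trmx_mul_self trmxK trmx_mul mulmxA -(mulmxA v) vG0 mul0mx mxE.
Qed.

(** For a basis [B] of the row space, take [P = B^T (B B^T)^-1 B], so that [B P = B]. As [A] and [B]
    are left multiples of each other, [A P = A] and [P = C A] follow. *)
Lemma row_space_projector (R : realFieldType) (m n : nat) (A : 'M[R]_(m, n)) :
  exists2 P : 'M[R]_n, [/\ P^T = P, P *m P = P & A *m P = A] &
    exists C, P = C *m A.
Proof.
set B := row_base A.
have uG : B *m B^T \in unitmx by apply/row_free_gram/row_base_free.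
have [X defA] : exists X, A = X *m B by apply/submxP; rewrite eq_row_base.
have [Y defB] : exists Y, B = Y *m A by apply/submxP; rewrite eq_row_base.
clearbody B.
have BP : B *m (B^T *m invmx (B *m B^T) *m B) = B.
  by rewrite !mulmxA mulmxV ?mul1mx.
exists (B^T *m invmx (B *m B^T) *m B); last first.
  by exists (B^T *m invmx (B *m B^T) *m Y); rewrite -!mulmxA -defB.
split; last by rewrite {1}defA -(mulmxA X) BP -defA.
  by rewrite !trmx_mul trmx_inv trmx_mul trmxK mulmxA.
by rewrite -[LHS]mulmxA BP.
Qed.

Lemma norm2_projector (R : realType) (n : nat) (P : 'M[R]_n) (v : 'cV[R]_n) :
  P^T = P -> P *m P = P -> norm2 (P *m v) <= norm2 v ?= iff (P *m v == v).
Proof.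
move=> Ptr Pidem; have sq_ge0 (u : 'cV[R]_n) : 0 <= \sum_i u i 0 ^+ 2.
  by apply: sumr_ge0 => i _; apply: sqr_ge0.
have pyth : \sum_i v i 0 ^+ 2 =
    \sum_i (P *m v) i 0 ^+ 2 + \sum_i (v - P *m v) i 0 ^+ 2.
  have tr_vPv : (v - P *m v)^T = v^T - v^T *m P.
    by rewrite linearB /= trmx_mul Ptr.
  rewrite -!trmx_mul_self tr_vPv trmx_mul Ptr mulmxBl !mulmxBr.
  (* With [a = v^T v] and [b = v^T P v], idempotence reduces the two squared lengths on the right to
     [b] and [a - b]. *)
  have addBE (a b : 'M[R]_1) : a 0 0 = b 0 0 + (a - b) 0 0.
    by rewrite !mxE [RHS]addrC subrK.
  by rewrite !mulmxA -(mulmxA _ P P) Pidem subrr subr0 -addBE.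
split; first by rewrite ler_sqrt // pyth lerDl.
rewrite eqr_sqrt // pyth -subr_eq0 opprD addrA subrr sub0r oppr_eq0.
by rewrite sum_sqr_eq0 subr_eq0 eq_sym.
Qed.

(** Monotonicity is given one coordinate at a time, hence an induction on the number of coordinates
    where [x] and [y] differ. *)
Lemma increasing_lt (R : realType) (m : nat) (f : 'rV[R]_m -> R)
    (x y : 'rV[R]_m) :
  increasing_in_each_argument f -> (forall i, 0 <= x 0 i) ->
  (forall i, x 0 i <= y 0 i) -> x != y -> f x < f y.
Proof.
move=> fincr x0; have [k] := ubnP #|[set i | x 0 i != y 0 i]|.
elim: k y => // k IHk y; rewrite ltnS => lek xy neq_xy.
have [j neqj] : exists j, x 0 j != y 0 j.
  apply/existsP; apply: contraNT neq_xy => /existsPn eqxy.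
  by apply/eqP/rowP => i; apply/eqP/negPn.
(* Lowering coordinate [j] of [y] to that of [x] decreases [f] strictly and leaves one difference
   fewer. *)
pose z : 'rV[R]_m := \row_i (if i == j then x 0 j else y 0 i).
have zj : z 0 j = x 0 j by rewrite mxE eqxx.
have zN i : i != j -> z 0 i = y 0 i by rewrite mxE => /negPf->.
have xz i : x 0 i <= z 0 i by have [->|/zN->] := eqVneq i j; rewrite ?zj.
have fzy : f z < f y.
  apply: (fincr j) => // [i|i|]; last by rewrite zj lt_neqAle neqj xy.
    exact: le_trans (xz i).
  exact: le_trans (xy i).
have [->//|neq_xz] := eqVneq x z.
apply: lt_trans (IHk z _ xz neq_xz) fzy; apply: leq_trans lek.
apply/proper_card/properP; split; last by exists j; rewrite inE ?zj ?eqxx.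
apply/subsetP => i; rewrite !inE; have [->|/zN->//] := eqVneq i j.
by rewrite zj eqxx.
Qed.

Theorem proposition11 (R : realType) (m n : nat) (A : 'M[R]_(m, n))
  (f : 'rV[R]_m -> R) (f_incr : increasing_in_each_argument f)
  (H : 'M[R]_(n, m))
  (H_opt : is_minimizer (fun X : 'M[R]_(n, m) => A *m X *m A = A)
                        (fun X : 'M[R]_(n, m) => f (col_norms X)) H) :
  H *m A *m H = H /\ (H *m A)^T = H *m A.
Proof.
case: H_opt => AHA Hmin.
have [P [Ptr Pidem AP] [C defP]] := row_space_projector _ _ _ A.
have col_le j :
    norm2 (col j (P *m H)) <= norm2 (col j H) ?= iff (col j (P *m H) == col j H).
  by rewrite !colE -mulmxA; apply: norm2_projector.
have PH : P *m H = H.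
  have norms_eq : col_norms (P *m H) = col_norms H.
    apply/eqP; apply: contraT => neq.
    have /Hmin : A *m (P *m H) *m A = A by rewrite mulmxA AP.
    rewrite leNgt increasing_lt // => i; rewrite !mxE ?sqrtr_ge0 //.
    by case: (col_le i).
  (* Equal norms are the equality case of [col_le], so [P] fixes each column of [H]. *)
  apply/matrixP => i j; have /rowP/(_ j) := norms_eq; rewrite !mxE.
  move/eqP; rewrite (col_le j).2 => /eqP/colP/(_ i).
  by rewrite !mxE.
have HA : H *m A = P by rewrite -PH defP -!mulmxA (mulmxA A) AHA.
(* What remains is [P *m H = H] and [P^T = P]. *)
by rewrite HA.
Qed.
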